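(* Let $k>1$ and let $\alpha(y_1,\dots,y_k)=c\oplus y_1\oplus\cdots\oplus y_k$, with $c\in GF(2)$, be a $k$-adic linear connective. Suppose the growth process $(\mu,\alpha)$ on $n$ variables has a limiting distribution $\pi$. If $i>\frac{2\log(n)}{\log(k)}$, then for any $n$-adic linear function $f$, $|\pi(f)-\pi_i(f)|<2^{-n}$.
   Context: A connective is a $k$-adic Boolean function $\alpha:\{0,1\}^k\to\{0,1\}$. Let $A_0=\{x_1,\dots,x_n,\bar x_1,\dots,\bar x_n,0,1\}$ be the set of projections on $n$ variables, their negations, and the two constant functions. The initial distribution $\mu$ is the uniform distribution on a subset of $A_0$ which contains the $n$ projections, may or may not contain their $n$ negations, and contains neither, one, or both constants. The growth process $(\mu,\alpha)$ gives distributions $\pi_i$ on $n$-adic Boolean functions: $\pi_0=\mu$, and for $i\ge1$, $\pi_i(f)$ is the probability that $\alpha(g_1,\dots,g_k)=f$ where $g_1,\dots,g_k$ are independent random functions distributed according to $\pi_{i-1}$. The limiting distribution is $\pi=\lim_{i\to\infty}\pi_i$ (pointwise) when it exists. A function is linear if it has the form $c_0\oplus c_1x_1\oplus\cdots\oplus c_nx_n$ with $c_j\in GF(2)$; linear connectives are assumed to depend on all their arguments. Logarithms are to base 2. *)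

(* Defs.v *)
From HB Require Import structures.
From mathcomp Require Import all_boot all_order all_algebra.
From mathcomp Require Import all_classical all_reals all_analysis.

Set Implicit Arguments.
Unset Strict Implicit.
Unset Printing Implicit Defensive.

Import Order.TTheory GRing.Theory Num.Theory.
Import numFieldNormedType.Exports.

Local Open Scope ring_scope.
Local Open Scope classical_set_scope.

(* {0,1} = GF(2) is represented by bool, with sum addb and product andb. *)
Definition boolfun (n : nat) := {ffun {ffun 'I_n -> bool} -> bool}.

Definition projf (n : nat) (j : 'I_n) : boolfun n := [ffun x : {ffun 'I_n -> bool} => x j].

Definition nprojf (n : nat) (j : 'I_n) : boolfun n := [ffun x : {ffun 'I_n -> bool} => ~~ x j].

Definition constf (n : nat) (b : bool) : boolfun n := [ffun=> b].

Definition base_functions (n : nat) : {set boolfun n} :=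
  [set f | [|| [exists j : 'I_n, f == projf j],
               [exists j : 'I_n, f == nprojf j]
             | [exists b : bool, f == constf n b]]]%SET.

(* The negated projections are in the support all together or not at all;
   each constant may be in it or not, independently. *)
Definition initial_support (n : nat) (S : {set boolfun n}) : Prop :=
  [/\ S \subset base_functions n,
      forall j : 'I_n, projf j \in S
    & (forall j : 'I_n, nprojf j \in S) \/
      (forall j : 'I_n, nprojf j \notin S)].

Definition uniform_on (R : realType) (T : finType) (S : {set T}) (f : T) : R :=
  (f \in S)%:R / #|S|%:R.

Definition compose (n k : nat) (alpha : boolfun k)
    (g : {ffun 'I_k -> boolfun n}) : boolfun n :=
  [ffun x : {ffun 'I_n -> bool} => alpha [ffun j => g j x]].

(* The law of alpha(g_1, ..., g_k) for independent g_j of law p: the sum, over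
   all k-tuples of functions mapped to f, of their product probability. *)
Definition growth_step (R : realType) (n k : nat) (alpha : boolfun k)
    (p : boolfun n -> R) (f : boolfun n) : R :=
  \sum_(g : {ffun 'I_k -> boolfun n} | compose alpha g == f)
    \prod_(j < k) p (g j).

Definition growth (R : realType) (n k : nat) (mu : boolfun n -> R)
    (alpha : boolfun k) (i : nat) : boolfun n -> R :=
  iter i (growth_step alpha) mu.

Definition limiting_distribution (R : realType) (n k : nat)
    (mu : boolfun n -> R) (alpha : boolfun k) (pi : boolfun n -> R) : Prop :=
  forall f : boolfun n, growth mu alpha i f @[i --> \oo] --> pi f.

Definition linear_fun (n : nat) (f : boolfun n) : Prop :=
  exists (c0 : bool) (c : 'I_n -> bool),
    forall x, f x = c0 (+) \big[addb/false]_(j < n) (c j && x j).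

Definition linear_connective (k : nat) (c : bool) : boolfun k :=
  [ffun y : {ffun 'I_k -> bool} => c (+) \big[addb/false]_(j < k) y j].

Definition log2 (R : realType) (x : R) : R := ln x / ln 2.

(* Main.v *)
(* Affine Boolean functions form a group isomorphic to GF(2)^(n+1) which carries every
   pi_i, and a growth step raises each Fourier coefficient to the k-th power, up to a
   sign. Coefficients of mu of modulus 1 become stationary after one step, because the
   limit exists; the others tend to 0, so |pi(f) - pi_i(f)| is at most 2^-(n+1) times
   the sum of their k^i-th powers in modulus. With N = |S| <= 2n + 2 such a coefficient
   has modulus at most 1 - 2/N <= n/(n+1), and k^i - 2 >= (n+1)(n-1); so Parseval's
   identity bounds that sum by (1/2)^(n-1) * 2^(n+1)/N = 4/N, which is less than 2 when
   N > 2, while for N <= 2 the sum vanishes. *)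
Require Import Defs.
From HB Require Import structures.
From mathcomp Require Import all_boot all_order all_algebra.
From mathcomp Require Import all_classical all_reals all_analysis.
From mathcomp Require Import ring lra zify.
Import Order.TTheory GRing.Theory Num.Theory.
Import numFieldNormedType.Exports.
Local Open Scope ring_scope.

(** * Affine Boolean functions *)

Definition zero_point (n : nat) : {ffun 'I_n -> bool} := [ffun=> false].

Definition xor_point (n : nat) (x y : {ffun 'I_n -> bool}) : {ffun 'I_n -> bool} :=
  [ffun j => x j (+) y j].

(** Linearity expressed by values instead of coefficients, so that stability under sums and under
    composition is a check on values. *)
Definition affine (n : nat) (f : boolfun n) : Prop :=
  forall x y, f (xor_point n x y) = f x (+) f y (+) f (zero_point n).

Definition affine_supported (R : realType) (n : nat) (p : boolfun n -> R) : Prop :=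
  forall f, p f != 0 -> affine n f.

(* For affine [f] the characters are all the sign functions of [f x] and of
   [f x (+) f 0]; stated through values of [f], they make sense, and are
   multiplicative, on all Boolean functions. *)
Definition freq (n : nat) : finType := (bool * {ffun 'I_n -> bool})%type.

Definition character (R : realType) (n : nat) (w : freq n) (f : boolfun n) : R :=
  (-1) ^+ (f w.2 (+) (w.1 && f (zero_point n))).

Definition fourier (R : realType) (n : nat) (p : boolfun n -> R) (w : freq n) : R :=
  \sum_f p f * character R n w f.

Definition xor_fun (n : nat) (f g : boolfun n) : boolfun n := [ffun x => f x (+) g x].

Lemma linear_fun_affine (n : nat) (f : boolfun n) : linear_fun f -> affine n f.
Proof.
move=> [c0 [c fE]] x y; rewrite !fE.
rewrite (eq_bigr (fun j => (c j && x j) (+) (c j && y j))); last first.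
  by move=> j _; rewrite ffunE andb_addr.
rewrite big_split /= [X in _ = _ (+) (_ (+) X)]big1; last first.
  by move=> j _; rewrite ffunE andbF.
by case: (c0); do 2 case: (\big[_/_]_(_ < _) _).
Qed.

Lemma base_affine (n : nat) (f : boolfun n) : f \in base_functions n -> affine n f.
Proof.
rewrite inE => /or3P[] /existsP[j /eqP->] x y; rewrite !ffunE.
- by case: (x j); case: (y j).
- by case: (x j); case: (y j).
- by case: j.
Qed.

Lemma xor_fun_affine (n : nat) (f g : boolfun n) :
  affine n f -> affine n g -> affine n (xor_fun n f g).
Proof.
move=> af ag x y; rewrite !ffunE af ag.
by do 3 case: (f _); do 3 case: (g _).
Qed.

Lemma compose_linearE (n k : nat) (c : bool) (g : {ffun 'I_k -> boolfun n}) x :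
  compose (linear_connective k c) g x = c (+) \big[addb/false]_(j < k) g j x.
Proof. by rewrite !ffunE; congr (_ (+) _); apply: eq_bigr => j _; rewrite ffunE. Qed.

Lemma compose_affine (n k : nat) (c : bool) (g : {ffun 'I_k -> boolfun n}) :
  (forall j, affine n (g j)) -> affine n (compose (linear_connective k c) g).
Proof.
move=> ag x y; rewrite !compose_linearE.
under eq_bigr do rewrite ag.
rewrite !big_split /=.
by case: c; do 3 case: (\big[_/_]_(_ < _) _).
Qed.

(** * Orthogonality of characters, Fourier inversion and Parseval *)

Lemma characterM (R : realType) (n : nat) (w : freq n) (f g : boolfun n) :
  character R n w f * character R n w g = character R n w (xor_fun n f g).
Proof.
rewrite /character -signr_addb !ffunE; congr ((-1) ^+ (nat_of_bool _)).
by case: w.1; do 2 case: (f _); do 2 case: (g _).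
Qed.

Lemma sum_character (R : realType) (n : nat) (h : boolfun n) : affine n h ->
  \sum_w character R n w h = (h == [ffun=> false])%:R * 2 ^+ n.+1.
Proof.
move=> ah; case: eqVneq => [->|hn0].
  rewrite mul1r (eq_bigr (fun=> 1)); last by move=> w _; rewrite /character !ffunE andbF.
  rewrite sumr_const card_prod card_bool card_ffun card_bool card_ord.
  by rewrite -expnS natrX.
rewrite mul0r.
transitivity (\sum_(a : bool) \sum_x character R n (a, x) h).
  by rewrite pair_bigA /=; apply: eq_bigr => -[].
rewrite big_bool /= /character /=.
under eq_bigr do rewrite signr_addb.
rewrite -mulr_suml.
under [X in _ + X]eq_bigr do rewrite addbF.
(* The half of the sum with [w.1] true is the other half times the sign of h(0), so the two cancel
   when h(0) = 1. *)
have [h0|h0] := boolP (h (zero_point n)); first by rewrite expr1 mulrN1 addNr.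
have [x0 hx0] : exists x0, h x0.
  apply/existsP; apply: contraNT hn0 => /existsPn hF.
  by apply/eqP/ffunP => x; rewrite ffunE; apply/negbTE/hF.
(* The translation by [x0] flips the sign of every term. *)
suff -> : \sum_x (-1) ^+ (h x) = 0 :> R by rewrite mul0r addr0.
set s := \sum_x _; suff : s = - s by move=> ?; lra.
have invx : involutive (xor_point n x0).
  by move=> x; apply/ffunP => j; rewrite !ffunE addKb.
rewrite {1}/s (reindex_inj (inv_inj invx)) /= -sumrN; apply: eq_bigr => x _.
by rewrite ah hx0 (negbTE h0) addbF addTb signrN.
Qed.

(** Exchanging the sums leaves, for each g, p(g) times the character sum of f + g. If p(g) is
    nonzero then f + g is affine, and its sum vanishes unless g = f. *)
Lemma fourier_inversion (R : realType) (n : nat) (p : boolfun n -> R) (f : boolfun n) :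
  affine_supported R n p -> affine n f ->
  \sum_w character R n w f * fourier R n p w = 2 ^+ n.+1 * p f.
Proof.
move=> ap af; rewrite /fourier.
under eq_bigr do rewrite mulr_sumr.
rewrite exchange_big /= (bigD1 f) //= [X in _ + X]big1 ?addr0 => [|g gf].
  under eq_bigr do rewrite mulrCA characterM.
  rewrite -mulr_sumr sum_character; last exact: xor_fun_affine.
  suff -> : xor_fun n f f = [ffun=> false] by rewrite eqxx mul1r mulrC.
  by apply/ffunP => x; rewrite !ffunE addbb.
under eq_bigr do rewrite mulrCA characterM.
rewrite -mulr_sumr; have [->|/ap ag] := eqVneq (p g) 0; first by rewrite mul0r.
rewrite sum_character; last exact: xor_fun_affine.
case: eqP => [/ffunP e|]; last by rewrite mul0r mulr0.
case/eqP: gf; apply/ffunP => x; move: (e x); rewrite !ffunE.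
by case: (f x); case: (g x).
Qed.

Lemma parseval (R : realType) (n : nat) (p : boolfun n -> R) :
  affine_supported R n p ->
  \sum_w fourier R n p w ^+ 2 = 2 ^+ n.+1 * \sum_f p f ^+ 2.
Proof.
move=> ap.
under eq_bigr do rewrite expr2 {1}/fourier mulr_suml.
rewrite exchange_big mulr_sumr /=; apply: eq_bigr => f _.
under eq_bigr do rewrite -mulrA.
rewrite -mulr_sumr; have [->|/ap af] := eqVneq (p f) 0.
  by rewrite mul0r expr0n mulr0.
by rewrite fourier_inversion // mulrCA expr2.
Qed.

(** * Growth steps on the Fourier side *)

(** The value of the character [w] at the constant function c. *)
Definition fourier_sign (R : realType) (n : nat) (c : bool) (w : freq n) : R :=
  (-1) ^+ (c (+) (w.1 && c)).

Lemma character_compose (R : realType) (n k : nat) (c : bool) (w : freq n)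
    (g : {ffun 'I_k -> boolfun n}) :
  character R n w (compose (linear_connective k c) g) =
  fourier_sign R n c w * \prod_(j < k) character R n w (g j).
Proof.
have prodE : \prod_(j < k) character R n w (g j) =
    (-1) ^+ (\big[addb/false]_(j < k) (g j w.2 (+) (w.1 && g j (zero_point n)))).
  by rewrite (big_morph (fun b : bool => (-1 : R) ^+ b) (id1 := 1) (id2 := false) (@signr_addb R)).
rewrite prodE /fourier_sign -signr_addb /character !compose_linearE big_split /=.
congr ((-1) ^+ (nat_of_bool _)).
case: w.1 => /=; last by rewrite [X in _ = _ (+) (_ (+) X)]big1 // !addbF.
by case: c; do 2 case: (\big[_/_]_(_ < _) _).
Qed.

(** Independence: the character of a composition is a product over the arguments, so its sum over
    all k-tuples factors into k equal sums. *)
Lemma fourier_step (R : realType) (n k : nat) (c : bool) (p : boolfun n -> R) (w : freq n) :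
  fourier R n (growth_step (linear_connective k c) p) w =
  fourier_sign R n c w * fourier R n p w ^+ k.
Proof.
rewrite {1}/fourier /growth_step.
transitivity (\sum_(g : {ffun 'I_k -> boolfun n})
   (\prod_(j < k) p (g j)) * character R n w (compose (linear_connective k c) g)).
  rewrite [RHS](partition_big (compose (linear_connective k c)) predT) //=.
  apply: eq_bigr => f _; rewrite mulr_suml.
  by apply: eq_bigr => g /eqP ->.
under eq_bigr do rewrite character_compose mulrCA -big_split /=.
rewrite -mulr_sumr; congr (_ * _).
rewrite -(bigA_distr_bigA (fun (_ : 'I_k) f => p f * character R n w f)) /=.
by rewrite prodr_const card_ord.
Qed.

Lemma growth_step_affine_supported (R : realType) (n k : nat) (c : bool) (p : boolfun n -> R) :
  affine_supported R n p -> affine_supported R n (growth_step (linear_connective k c) p).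
Proof.
move=> ap f; rewrite /growth_step => /eqP nz; apply: contrapT => naf; apply: nz.
rewrite big1 // => g /eqP gf.
have [/forallP h|] := boolP [forall j, p (g j) != 0].
  by case: naf; rewrite -gf; apply: compose_affine => j; exact: ap.
by rewrite negb_forall => /existsP[j]; rewrite negbK => /eqP pj; rewrite (bigD1 j) //= pj mul0r.
Qed.

Lemma growth_affine_supported (R : realType) (n k : nat) (c : bool) (p : boolfun n -> R) i :
  affine_supported R n p -> affine_supported R n (growth p (linear_connective k c) i).
Proof. by move=> ap; elim: i => //= i; exact: growth_step_affine_supported. Qed.

Lemma norm_fourier_growth (R : realType) (n k : nat) (c : bool) (p : boolfun n -> R) w i :
  `|fourier R n (growth p (linear_connective k c) i) w| = `|fourier R n p w| ^+ (k ^ i).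
Proof.
elim: i => [|i IH]; first by rewrite expn0 expr1.
rewrite -[growth _ _ i.+1]/(growth_step _ (growth p (linear_connective k c) i)).
by rewrite fourier_step normrM normr_sign mul1r normrX IH -exprM -expnSr.
Qed.

(** * Estimates for the initial distribution and for the exponent *)

Lemma card_base_functions (n : nat) : (#|base_functions n| <= 2 * n + 2)%N.
Proof.
have sub : base_functions n \subset
    [set projf j | j : 'I_n] :|: [set nprojf j | j : 'I_n] :|: [set constf n b | b : bool].
  apply/fintype.subsetP => f; rewrite !inE => /or3P[] /existsP[j /eqP ->].
  - by rewrite imset_f.
  - by rewrite imset_f ?orbT.
  - by rewrite imset_f ?orbT.
apply: leq_trans (subset_leq_card sub) _.
have c1 := leq_imset_card (@projf n) 'I_n.
have c2 := leq_imset_card (@nprojf n) 'I_n.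
have c3 := leq_imset_card (@constf n) {: bool}.
rewrite !card_ord card_bool in c1 c2 c3.
apply: leq_trans (leq_card_setU _ _).1 _.
apply: leq_trans (leq_add (leq_trans (leq_card_setU _ _).1 (leq_add c1 c2)) c3) _.
lia.
Qed.

(* A sum of [N] signs has the parity of [N], so it is at most [N - 2] in absolute
   value as soon as it is less than [N]. *)
Lemma norm_fourier_uniform (R : realType) (n : nat) (S : {set boolfun n}) w :
  (0 < #|S|)%N -> `|fourier R n (uniform_on R S) w| < 1 ->
  `|fourier R n (uniform_on R S) w| <= (#|S| - 2)%:R / #|S|%:R.
Proof.
move=> S0; have N0 : 0 < #|S|%:R :> R by rewrite ltr0n.
(* [D] collects the functions of [S] with character value -1, so the signs add up to |S| - 2|D|. *)
set D := [set f in S | f w.2 (+) (w.1 && f (zero_point n))].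
have DS : (#|D| <= #|S|)%N.
  by apply/subset_leq_card/fintype.subsetP => f; rewrite inE => /andP[].
have -> : fourier R n (uniform_on R S) w = (#|S|%:R - 2 * #|D|%:R) / #|S|%:R.
  rewrite /fourier /uniform_on.
  under eq_bigr do rewrite mulrAC.
  rewrite -mulr_suml; congr (_ / _).
  rewrite (bigID (mem S)) /= [X in _ + X]big1 ?addr0; last first.
    by move=> f /negbTE ->; rewrite mul0r.
  rewrite (eq_bigr (fun f => 1 - 2 * (f \in D)%:R)); last first.
    move=> f fS; rewrite inE fS /= mul1r /character.
    by case: (_ (+) _); rewrite /= ?expr1 ?expr0; ring.
  rewrite sumrB sumr_const; congr (_ - _).
  rewrite -mulr_sumr; congr (_ * _).
  rewrite -natr_sum; congr (_%:R).
  rewrite -big_mkcondr /= sum1_card; apply: eq_card => f.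
  by rewrite [LHS]unfold_in !inE andbA andbb.
rewrite normrM normfV (gtr0_norm N0) ltr_pdivrMr // mul1r ler_pM2r ?invr_gt0 //.
rewrite ltr_norml => /andP[h1 h2].
have d0 : (0 < #|D|)%N by rewrite -(@ltr0n R); lra.
have dN : (#|D| < #|S|)%N by rewrite -(@ltr_nat R); lra.
rewrite natrB; last lia.
have d0' : 1 <= #|D|%:R :> R by rewrite ler1n.
have dN' : #|D|%:R + 1 <= #|S|%:R :> R by rewrite natr1 ler_nat.
rewrite ler_norml; apply/andP; split; lra.
Qed.

Lemma uniform_affine_supported (R : realType) (n : nat) (S : {set boolfun n}) :
  S \subset base_functions n -> affine_supported R n (uniform_on R S).
Proof.
move=> /fintype.subsetP sub f; rewrite /uniform_on.
by case: (boolP (f \in S)) => [/sub/base_affine //|]; rewrite mul0r eqxx.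
Qed.

Lemma sum_sqr_uniform (R : realType) (T : finType) (S : {set T}) : (0 < #|S|)%N ->
  \sum_f uniform_on R S f ^+ 2 = #|S|%:R^-1.
Proof.
move=> S0; have N0 : #|S|%:R != 0 :> R by rewrite pnatr_eq0 -lt0n.
rewrite (bigID (mem S)) /= [X in _ + X]big1 ?addr0; last first.
  by move=> f /negbTE fS; rewrite /uniform_on fS mul0r expr0n.
rewrite (eq_bigr (fun=> (#|S|%:R^-1) ^+ 2)); last first.
  by move=> f fS; rewrite /uniform_on fS mul1r.
by rewrite sumr_const -[LHS]mulr_natl expr2 mulrA divff // mul1r.
Qed.

(** Bernoulli's inequality in integer form, taken at m = n; it says that (n/(n+1))^(n+1) is at most
    1/2. *)
Lemma double_expn_leq (n : nat) : (2 * n ^ n.+1 <= n.+1 ^ n.+1)%N.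
Proof.
have bern m : (n ^ m.+1 + m.+1 * n ^ m <= n.+1 ^ m.+1)%N.
  elim: m => [|m IH]; first by rewrite expn0 !expn1; lia.
  rewrite [(n.+1 ^ _)%N]expnS; apply: leq_trans (leq_mul (leqnn _) IH).
  rewrite ![(n ^ m.+2)%N]expnS ![(n ^ m.+1)%N]expnS.
  set X := (n ^ m)%N; nia.
apply: leq_trans (bern n); rewrite expnS; lia.
Qed.

Lemma fourier_tail (R : realType) (n q : nat) (S : {set boolfun n}) :
  (0 < n)%N -> (0 < #|S|)%N -> S \subset base_functions n -> (n ^ 2 < q)%N ->
  \sum_(w | `|fourier R n (uniform_on R S) w| < 1)
     `|fourier R n (uniform_on R S) w| ^+ q < 2.
Proof.
move=> n0 S0 sub nq.
have qn : (n.+1 * n.-1 <= q - 2)%N.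
  by case: n n0 nq {S S0 sub} => // n _; rewrite -mulnn /=; nia.
have q2 : (2 <= q)%N by apply: leq_ltn_trans nq; rewrite expn_gt0 n0.
set F := fourier R n (uniform_on R S).
have Fle w : `|F w| < 1 -> `|F w| <= (#|S| - 2)%:R / #|S|%:R.
  exact: norm_fourier_uniform.
have N0 : 0 < #|S|%:R :> R by rewrite ltr0n.
(* For |S| at most 2 the truncated difference |S| - 2 is 0, so each term is 0^q with q > 0. *)
have [N2|N3] := leqP #|S| 2.
  rewrite big1 // => w /Fle.
  have -> : (#|S| - 2 = 0)%N by lia.
  rewrite mul0r normr_le0 => /eqP ->; rewrite normr0 expr0n.
  by have -> : (q == 0)%N = false by lia.
set x := (#|S| - 2)%:R / #|S|%:R in Fle.
have x0 : 0 <= x by rewrite divr_ge0 // ler0n.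
have x1 : x <= n%:R / n.+1%:R.
  (* After cross-multiplication this is |S| <= 2n + 2. *)
  rewrite ler_pdivrMr // mulrAC ler_pdivlMr ?ltr0n // -!natrM ler_nat.
  have := leq_trans (subset_leq_card sub) (card_base_functions n); nia.
have y1 : n%:R / n.+1%:R <= 1 :> R.
  by rewrite ler_pdivrMr ?ltr0n // mul1r ler_nat.
have half : (n%:R / n.+1%:R) ^+ n.+1 <= 2^-1 :> R.
  rewrite expr_div_n ler_pdivrMr ?exprn_gt0 ?ltr0n // ler_pdivlMl //.
  by rewrite -!natrX -natrM ler_nat double_expn_leq.
have xq : x ^+ (q - 2) <= 2^-1 ^+ n.-1.
  apply: le_trans (_ : (n%:R / n.+1%:R) ^+ (n.+1 * n.-1) <= _); last first.
    by rewrite exprM lerXn2r // nnegrE ?exprn_ge0 ?divr_ge0 ?ler0n ?invr_ge0.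
  apply: le_trans (_ : (n%:R / n.+1%:R) ^+ (q - 2) <= _).
    by rewrite lerXn2r // nnegrE divr_ge0 ?ler0n.
  by rewrite ler_wiXn2l ?divr_ge0 ?ler0n.
(* Two of the q factors are kept as a square for Parseval; the other q - 2 are bounded uniformly,
   and the sum is then extended to all frequencies. *)
have le1 : \sum_(w | `|F w| < 1) `|F w| ^+ q <= 2^-1 ^+ n.-1 * \sum_w F w ^+ 2.
  rewrite mulr_sumr big_mkcond /=; apply: ler_sum => w _; case: ifP => [/Fle Fw|_]; last first.
    by rewrite mulr_ge0 ?sqr_ge0 ?exprn_ge0 ?invr_ge0.
  rewrite -[in leLHS](subnK q2) exprD real_normK ?num_real // ler_wpM2r ?sqr_ge0 //.
  by apply: le_trans xq; rewrite lerXn2r // nnegrE.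
apply: le_lt_trans le1 _.
rewrite parseval; last exact: uniform_affine_supported.
rewrite sum_sqr_uniform // mulrA -{2}(prednK n0) 2!exprSr !mulrA -exprMn mulVf // expr1n mul1r.
by rewrite ltr_pdivrMr // ltr_pM2l // ltr_nat.
Qed.

(** The base of the logarithms cancels in the quotient. Positivity of i comes from log n >= 0; it is
    recorded because a coefficient of modulus 1 may still change at the first step. *)
Lemma log_bound (R : realType) (n k i : nat) : (0 < n)%N -> (1 < k)%N ->
  2 * log2 (n%:R : R) / log2 (k%:R : R) < i%:R -> (0 < i)%N /\ (n ^ 2 < k ^ i)%N.
Proof.
move=> n0 k1; rewrite /log2.
have l2 : 0 < ln (2 : R) by rewrite ln_gt0 // ltr1n.
have lk : 0 < ln (k%:R : R) by rewrite ln_gt0 // ltr1n.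
have ln0 : 0 <= ln (n%:R : R) by rewrite ln_ge0 // ler1n.
have -> : 2 * (ln (n%:R : R) / ln 2) / (ln k%:R / ln 2) = 2 * ln n%:R / ln k%:R.
  by field; rewrite !gt_eqF.
move=> h; split.
  by rewrite -(ltr0n R); apply: le_lt_trans h; rewrite divr_ge0 ?mulr_ge0 // ltW.
move: h; rewrite ltr_pdivrMr // => h.
rewrite -(ltr_nat R) !natrX -ltr_ln ?posrE ?exprn_gt0 ?ltr0n //; last lia.
by rewrite !lnXn ?ltr0n //; [rewrite -!(mulr_natl (ln _))|lia].
Qed.

(** * Passage to the limit *)

Lemma cvg_fourier (R : realType) (n : nat) (u : nat -> boolfun n -> R) (p : boolfun n -> R) w :
  (forall f, (u i f @[i --> \oo] --> p f)%classic) ->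
  (fourier R n (u i) w @[i --> \oo] --> fourier R n p w)%classic.
Proof.
move=> up; rewrite /fourier; apply: cvg_big => [|f _]; first exact: add_continuous.
by apply: cvgM; [exact: up | exact: cvg_cst].
Qed.

(** The limit L of the coefficients is a fixed point of z -> e z^k, where e is the sign of the step.
    This forces L = 0 below modulus 1, and at modulus 1 it reduces the claim to the parity of k. *)
Lemma limit_fourier (R : realType) (n k : nat) (c : bool) (mu pi : boolfun n -> R) w i :
  (1 < k)%N -> (0 < i)%N ->
  limiting_distribution mu (linear_connective k c) pi ->
  `|fourier R n mu w| <= 1 ->
  `|fourier R n pi w - fourier R n (growth mu (linear_connective k c) i) w| =
  if `|fourier R n mu w| < 1 then `|fourier R n mu w| ^+ (k ^ i) else 0.
Proof.
move=> k1 i0 lim mu1.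
pose a j := fourier R n (growth mu (linear_connective k c) j) w.
set L := fourier R n pi w; set e := fourier_sign R n c w.
have aL : (a j @[j --> \oo] --> L)%classic by exact: cvg_fourier.
have aS j : a j.+1 = e * a j ^+ k by rewrite /a /= fourier_step.
have an j : `|a j| = `|a 0%N| ^+ (k ^ j) by rewrite /a norm_fourier_growth.
have Le : L = e * L ^+ k.
  have h1 : (a j.+1 @[j --> \oo] --> L)%classic by rewrite -cvg_shiftS in aL.
  have h2 : (a j.+1 @[j --> \oo] --> e * L ^+ k)%classic.
    rewrite (_ : (fun j => a j.+1) = (fun j => e * a j ^+ k)); last by apply/funext.
    by apply: cvgM; [exact: cvg_cst | exact: (cvg_comp _ _ aL (@exprn_continuous R k L))].
  exact: (cvg_unique _ h1 h2).
have e1 : `|e| = 1 by rewrite normr_sign.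
have nL : (`|a j| @[j --> \oo] --> `|L|)%classic by exact: cvg_norm.
rewrite -/(a i) -[fourier R n mu w]/(a 0%N) in mu1 *.
case: ifP => [lt1|/negbT].
  have L0 : L = 0.
    (* Every |a_j| is at most |a_0| < 1, and this bound passes to the limit. *)
    have Llt : `|L| < 1.
      apply: le_lt_trans lt1; rewrite -(cvg_lim _ nL) //.
      apply: limr_le; first by apply/cvg_ex; eexists; exact: nL.
      near=> j; rewrite an -[leRHS]expr1 ler_wiXn2l // expn_gt0; lia.
    apply/eqP; rewrite -normr_eq0; apply: contraLR Llt => Ln0; rewrite -leNgt.
    (* A nonzero L could be cancelled, giving |L|^(k-1) = 1 with k - 1 > 0, against |L| < 1. *)
    have : `|L| = `|L| * `|L| ^+ k.-1 by rewrite -exprS prednK; [rewrite -normrX {1}Le normrM e1 mul1r|lia].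
    rewrite -{1}[`|L|]mulr1 => /(mulfI Ln0) e2.
    rewrite leNgt; apply/negP => l1; move: (@exprn_ilt1 R k.-1 _ (normr_ge0 L) l1).
    by rewrite -e2 ltxx; lia.
  by rewrite L0 sub0r normrN an.
rewrite -leNgt => ge1.
have a01 : `|a 0%N| = 1 by apply/le_anti; rewrite mu1 ge1.
have aj1 j : `|a j| = 1 by rewrite an a01 expr1n.
have L1 : `|L| = 1.
  rewrite -(cvg_lim _ nL) // (_ : (fun j => `|a j|) = fun=> 1); first exact: lim_cst.
  by apply/funext.
have sq (z : R) : `|z| = 1 -> z ^+ 2 = 1 :> R by move=> z1; rewrite -real_normK ?num_real // z1 expr1n.
suff -> : a i = L by rewrite subrr normr0.
(* For odd [k] the sequence [a] is multiplied by [e] at each step, so convergence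
   forces [e = 1]; for even [k] it is equal to [e] from index 1 on. *)
have [ok|ek] := boolP (odd k).
  have oddX (z : R) : `|z| = 1 -> z ^+ k = z.
    by move=> /sq z1; rewrite -[in LHS](odd_double_half k) ok -mul2n exprD exprM z1 expr1n mulr1.
  have e1' : e = 1.
    have Ln0 : L != 0 by rewrite -normr_eq0 L1 oner_eq0.
    by apply/esym/(mulIf Ln0); rewrite mul1r {1}Le oddX.
  have acst j : a j = a 0%N by elim: j => // j <-; rewrite aS e1' mul1r oddX.
  rewrite acst -(cvg_lim _ aL) // (_ : a = fun=> a 0%N) ?lim_cst //; exact/funext.
have evenX (z : R) : `|z| = 1 -> z ^+ k = 1.
  by move=> /sq z1; rewrite -[in LHS](odd_double_half k) (negbTE ek) -mul2n exprM z1 expr1n.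
by rewrite Le evenX // -(prednK i0) aS evenX.
Unshelve. all: by end_near.
Qed.

Lemma norm_fourier_uniform_le1 (R : realType) (n : nat) (S : {set boolfun n}) w :
  `|fourier R n (uniform_on R S) w| <= 1.
Proof.
have [S0|S0] := posnP #|S|.
  (* For empty [S] the inverse of 0 is 0, so all weights vanish. *)
  rewrite /fourier big1 ?normr0 // => f _.
  by rewrite /uniform_on S0 invr0 mulr0 mul0r.
have N0 : #|S|%:R != 0 :> R by rewrite pnatr_eq0 -lt0n.
apply: le_trans (ler_norm_sum _ _ _) _.
rewrite (eq_bigr (fun f => (f \in S)%:R / #|S|%:R)); last first.
  by move=> f _; rewrite normrM normr_sign mulr1 ger0_norm // divr_ge0 ?ler0n.
by rewrite -mulr_suml -natr_sum -big_mkcond /= sum1_card divff.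
Qed.

Theorem theorem3p4 (R : realType) (n k : nat) (c : bool)
    (S : {set boolfun n}) (pi : boolfun n -> R) :
  (0 < n)%N -> (1 < k)%N ->
  initial_support S ->
  limiting_distribution (uniform_on R S) (linear_connective k c) pi ->
  forall i : nat,
    2 * log2 (n%:R : R) / log2 (k%:R : R) < i%:R ->
    forall f : boolfun n, linear_fun f ->
      `|pi f - growth (uniform_on R S) (linear_connective k c) i f| < 2 ^- n.
Proof.
move=> n0 k1 [sub projS _] lim i ilog f /linear_fun_affine af.
have [i0 ki] := log_bound R n k i n0 k1 ilog.
have S0 : (0 < #|S|)%N by rewrite card_gt0; apply/set0Pn; exists (projf (Ordinal n0)).
set mu := uniform_on R S in lim *.
have amu : affine_supported R n mu by exact: uniform_affine_supported.
(* At a function that is not affine every pi_i is 0, hence so is the limit. *)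
have api : affine_supported R n pi.
  move=> g /eqP nz; apply: contrapT => nag; apply: nz.
  rewrite -(cvg_lim _ (lim g)) //.
  rewrite (_ : (fun j => _) = fun=> 0) ?lim_cst //; apply/funext => j.
  by apply/eqP/negPn/negP => /(growth_affine_supported R n k c mu j amu).
set p := growth mu _ i.
have ap : affine_supported R n p by exact: growth_affine_supported.
have P0 : 0 < 2 ^+ n.+1 :> R by rewrite exprn_gt0.
(* Scaling by 2^(n+1) turns the target 2^-n into 2 and both values into sums given by Fourier
   inversion. *)
rewrite -(ltr_pM2l P0) -{1}(gtr0_norm P0) -normrM mulrBr.
rewrite -!fourier_inversion // -sumrB exprS -mulrA divff ?expf_neq0 // mulr1.
apply: le_lt_trans (ler_norm_sum _ _ _) _.
apply: le_lt_trans (fourier_tail R n (k ^ i) S n0 S0 sub ki).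
(* Frequencies of modulus 1 contribute 0 on both sides. *)
rewrite [leRHS]big_mkcond /=; apply: ler_sum => w _.
by rewrite -mulrBr normrM normr_sign mul1r limit_fourier // norm_fourier_uniform_le1.
Qed.
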